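(* Let $\alpha_i\ge 0$, $\beta_i>0$ ($1\le i\le 5$) and $Q>0$ be real numbers, and consider the networks $N$ and $N^+$ with these parameters and total flow $Q$. Suppose that at equilibria $N$ has no path with vanishing flow and $P_3$ is the only path with non-vanishing flow in $N^+$. Then Braess' paradox occurs in $N/N^+$ (i.e. $T^+_{Eq}>T_{Eq}$) if and only if $\mathcal B_2>0$ and $$\max\left\{\frac{\alpha}{\beta_{12}},\ \frac{-\alpha}{\beta_{45}},\ \frac{\hat\alpha\beta_{45}+\bar\alpha\beta_{12}}{\mathcal B_2}\right\} < Q \le \min\left\{\frac{\hat\alpha}{\beta_{35}},\ \frac{\bar\alpha}{\beta_{13}}\right\}.$$
   Context: The network $N^+$ has nodes $a,b,c,d$ and directed links $(a,b),(b,d),(b,c),(a,c),(c,d)$ with travel times $\alpha_1+\beta_1f_{ab}$, $\alpha_2+\beta_2f_{bd}$, $\alpha_3+\beta_3f_{bc}$, $\alpha_4+\beta_4f_{ac}$, $\alpha_5+\beta_5f_{cd}$ respectively, where $f_{ij}\ge 0$ is the (real) flow on link $(i,j)$ and $\alpha_i\ge 0$, $\beta_i>0$. All traffic, of total amount $Q>0$ (real), goes from $a$ to $d$ along the paths $P_1=a-b-d$, $P_2=a-c-d$, $P_3=a-b-c-d$. The network $N$ is $N^+$ with the link $(b,c)$ removed, so its paths are $P_1,P_2$ only. A flow assigns a non-negative real amount to each path, with total $Q$; the flow on a link is the sum of the flows of the paths containing it; the travel time on a path is the sum of the travel times of its links. A path has vanishing flow if its path flow is $0$, and non-vanishing flow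 otherwise. A network is at equilibrium if all paths with non-vanishing flow have the same travel time, and every path with vanishing flow has travel time at least this common value. The equilibrium exists and is unique; its common travel time is denoted $T_{Eq}$ for $N$ and $T^+_{Eq}$ for $N^+$. Braess' paradox is said to occur in $N/N^+$ for the total flow $Q$ if $T^+_{Eq}>T_{Eq}$. Notation: multiple indices denote sums, e.g. $\alpha_{ij}=\alpha_i+\alpha_j$, $\beta_{135}=\beta_1+\beta_3+\beta_5$. Further, $\alpha=\alpha_{45}-\alpha_{12}$, $\bar\alpha=\alpha_4-\alpha_{13}$, $\hat\alpha=\alpha_2-\alpha_{35}$, $\beta=\beta_1+\beta_2+\beta_4+\beta_5$, and $\mathcal B_2=\beta_{135}\beta-\beta_{12}\beta_{45}$. *)

(* Defs.v *)
From HB Require Import structures.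
From mathcomp Require Import all_boot all_order all_algebra.
From mathcomp Require Import classical_sets reals.

Set Implicit Arguments.
Unset Strict Implicit.
Unset Printing Implicit Defensive.

Import Order.TTheory GRing.Theory Num.Theory.
Local Open Scope ring_scope.

Inductive node := na | nb | nc | nd.

Definition nat_of_node (x : node) : nat :=
  match x with na => 0 | nb => 1 | nc => 2 | nd => 3 end.
Definition node_of_nat (n : nat) : node :=
  match n with 0 => na | 1 => nb | 2 => nc | _ => nd end.
Lemma nat_of_nodeK : cancel nat_of_node node_of_nat.
Proof. by case. Qed.
HB.instance Definition _ := Equality.copy node (can_type nat_of_nodeK).

Definition link : Type := node * node.

(* A network is given by its list of directed links. *)
Definition network : Type := seq link.

Definition netNplus : network := [:: (na, nb); (nb, nd); (nb, nc); (na, nc); (nc, nd)].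
Definition netN : network := rem (nb, nc) netNplus.

(* The index i such that alpha_i, beta_i are the parameters of the link; the
   value 0 on pairs that are not links is never used. *)
Definition link_index (l : link) : nat :=
  match l with
  | (na, nb) => 1 | (nb, nd) => 2 | (nb, nc) => 3 | (na, nc) => 4 | (nc, nd) => 5
  | _ => 0
  end.

(* Paths are sequences of visited nodes. *)
Definition P1 : seq node := [:: na; nb; nd].
Definition P2 : seq node := [:: na; nc; nd].
Definition P3 : seq node := [:: na; nb; nc; nd].

Definition path_links (p : seq node) : seq link := zip p (behead p).

(* The paths from na to nd all of whose links are in the network. *)
Definition paths (E : network) : seq (seq node) :=
  [seq p <- [:: P1; P2; P3] | all (mem E) (path_links p)].

Lemma paths_complete (s : seq node) :
  path (fun x y => (x, y) \in netNplus) na s && (last na s == nd) =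
  (na :: s \in paths netNplus).
Proof. by case: s => [|[] [|[] [|[] [|[] ?]]]]. Qed.

Lemma paths_Nplus : paths netNplus = [:: P1; P2; P3]. Proof. by []. Qed.

Lemma paths_N : paths netN = [:: P1; P2]. Proof. by []. Qed.

Section Equilibrium.
Variables (R : realType) (alpha beta : nat -> R).
Implicit Types (E : network) (Q T : R) (p q : seq node).

(* A flow on E is a function on all node sequences of which only the values on
   the paths of E are ever used. *)
Implicit Type f : seq node -> R.

Definition is_flow E Q f : Prop :=
  (forall p, p \in paths E -> 0 <= f p) /\ \sum_(p <- paths E) f p = Q.

Definition vanishing f p : Prop := f p = 0.

Definition link_flow E f (l : link) : R :=
  \sum_(p <- paths E | l \in path_links p) f p.

Definition link_time (l : link) (x : R) : R :=
  alpha (link_index l) + beta (link_index l) * x.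

Definition path_time E f p : R :=
  \sum_(l <- path_links p) link_time l (link_flow E f l).

Definition common_time E f T : Prop :=
  forall p, p \in paths E -> ~ vanishing f p -> path_time E f p = T.

Definition is_equilibrium E Q f : Prop :=
  is_flow E Q f /\
  exists T, common_time E f T /\
    forall p, p \in paths E -> vanishing f p -> T <= path_time E f p.

(* For E one of the two networks, 0 < Q, 0 <= alpha i and 0 < beta i, the set
   below is a singleton, so that the default value 0 is irrelevant. *)
Definition T_Eq E Q : R :=
  xget 0 [set T | exists f, is_equilibrium E Q f /\ common_time E f T]%classic.

Definition Braess_paradox Q : Prop := T_Eq netNplus Q > T_Eq netN Q.

Definition alpha_ : R := (alpha 4%N + alpha 5%N) - (alpha 1%N + alpha 2%N).
Definition alpha_bar : R := alpha 4%N - (alpha 1%N + alpha 3%N).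
Definition alpha_hat : R := alpha 2%N - (alpha 3%N + alpha 5%N).
Definition beta_ : R := beta 1%N + beta 2%N + beta 4%N + beta 5%N.
Definition B2 : R :=
  (beta 1%N + beta 3%N + beta 5%N) * beta_ - (beta 1%N + beta 2%N) * (beta 4%N + beta 5%N).

End Equilibrium.

(* Main.v *)
(** The equilibrium travel time is well defined: if f and g are equilibria with
    common times T and S, then the variational inequality
    sum_p t_p(f) (g_p - f_p) >= 0, and the one with f and g exchanged, give
    sum_l beta_l (f_l - g_l)^2 <= 0 over the links l, so f and g have the same
    link flows and T = S. The two given equilibria then determine the times
    through the linear system T = t_{P1} = t_{P2} on N and through
    T+ = t_{P3} on N+, and T+ > T becomes
    hat-alpha beta_45 + bar-alpha beta_12 < B2 Q. Its left-hand side is positive,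
    because P1 and P2 being no faster than P3 in N+ forces
    hat-alpha, bar-alpha > 0; hence B2 > 0. *)
Require Import Defs.
From mathcomp Require Import all_boot all_order all_algebra.
From mathcomp Require Import classical_sets reals.
From mathcomp Require Import ring lra.
Import Order.TTheory GRing.Theory Num.Theory.
Local Open Scope ring_scope.

(** Each path meets its links in the order of [netNplus], so filtering returns its own list; a range
    independent of [p] lets sums over paths and links be exchanged. *)
Lemma big_path_links {R : realType} {E : network} {p : seq node} (F : link -> R) :
  p \in paths E ->
  \sum_(l <- path_links p) F l = \sum_(l <- netNplus | l \in path_links p) F l.
Proof.
rewrite mem_filter => /andP[_]; rewrite !inE -[RHS]big_filter.
by case/or3P => /eqP->.
Qed.

(** Double counting of pairs of a path and a link on it. If [E] is [netN], the link (b,c) lies on no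
    path and contributes 0. *)
Lemma sum_path_time (R : realType) (alpha beta : nat -> R) (E : network)
    (f g : seq node -> R) :
  \sum_(p <- paths E) path_time alpha beta E f p * g p =
  \sum_(l <- netNplus) link_time alpha beta l (link_flow E f l) * link_flow E g l.
Proof.
under [RHS]eq_bigr do rewrite big_distrr /= big_mkcond.
rewrite exchange_big /=; apply: eq_big_seq => p pE.
by rewrite /path_time (big_path_links _ pE) big_distrl /= big_mkcond.
Qed.

Lemma flow_path_exists {R : realType} {E : network} {Q : R} {f : seq node -> R} :
  0 < Q -> is_flow E Q f -> exists2 p, p \in paths E & ~ vanishing f p.
Proof.
move=> Q0 [_ fQ].
have [/hasP[p pE /eqP fp]|/hasPn fN] := boolP (has (fun p => f p != 0) (paths E)).
  by exists p.
suff Q_0 : Q = 0 by move: Q0; rewrite Q_0 ltxx.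
by rewrite -fQ big_seq big1 // => p /fN/negPn/eqP.
Qed.

Section TravelTime.
Context {R : realType} {alpha beta : nat -> R} {E : network} {Q : R}.
Hypotheses (hbeta : forall i : nat, (1 <= i <= 5)%N -> 0 < beta i) (Q0 : 0 < Q).

(** [T] and the bound [T'] from the equilibrium condition agree: both are the time of some path with
    non-vanishing flow, which exists as Q > 0. *)
Lemma common_time_le {f : seq node -> R} {T : R} {p : seq node} :
  is_equilibrium alpha beta E Q f -> common_time alpha beta E f T ->
  p \in paths E -> T <= path_time alpha beta E f p.
Proof.
move=> [flf [T' [cT' minT']]] cT pE.
have [q qE fq] := flow_path_exists Q0 flf.
have -> : T = T' by rewrite -(cT q qE fq) (cT' q qE fq).
by have [/minT'->//|/eqP/cT'->] := eqVneq (f p) 0.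
Qed.

Lemma equilibrium_cost {f : seq node -> R} {T : R} :
  is_equilibrium alpha beta E Q f -> common_time alpha beta E f T ->
  \sum_(p <- paths E) path_time alpha beta E f p * f p = T * Q.
Proof.
move=> [[_ <-] _] cT; rewrite big_distrr /=; apply: eq_big_seq => p pE.
by have [->|/eqP/(cT p pE)->//] := eqVneq (f p) 0; rewrite !mulr0.
Qed.

(** Variational inequality: at the travel times fixed by [f] no path is faster than [T]. *)
Lemma equilibrium_cost_le {f g : seq node -> R} {T : R} :
  is_equilibrium alpha beta E Q f -> common_time alpha beta E f T ->
  is_flow E Q g ->
  T * Q <= \sum_(p <- paths E) path_time alpha beta E f p * g p.
Proof.
move=> ef cT [g0 <-]; rewrite big_distrr /= big_seq [leRHS]big_seq.
by apply: ler_sum => p pE; rewrite ler_wpM2r ?g0 // (common_time_le ef).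
Qed.

Lemma equilibrium_time_unique {f g : seq node -> R} {T S : R} :
  is_equilibrium alpha beta E Q f -> common_time alpha beta E f T ->
  is_equilibrium alpha beta E Q g -> common_time alpha beta E g S -> T = S.
Proof.
move=> ef cT eg cS.
have ff := equilibrium_cost ef cT.
have gg := equilibrium_cost eg cS.
have fg := equilibrium_cost_le ef cT (proj1 eg).
have gf := equilibrium_cost_le eg cS (proj1 ef).
rewrite !sum_path_time in ff gg fg gf.
(* [D l] is the change in travel time of [l] between [f] and [g] times the change in its flow;
   [alpha] cancels. *)
pose D l := beta (link_index l) * (link_flow E f l - link_flow E g l) ^+ 2.
have b0 l : l \in netNplus -> 0 < beta (link_index l).
  by move=> lN; apply: hbeta; move: l lN; apply/allP.
have D0 l : l \in netNplus -> 0 <= D l.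
  by move=> lN; rewrite mulr_ge0 ?sqr_ge0 // ltW // b0.
have sumD : \sum_(l <- netNplus) D l =
    \sum_(l <- netNplus) link_time alpha beta l (link_flow E f l) * link_flow E f l
  - \sum_(l <- netNplus) link_time alpha beta l (link_flow E f l) * link_flow E g l
  + (\sum_(l <- netNplus) link_time alpha beta l (link_flow E g l) * link_flow E g l
  - \sum_(l <- netNplus) link_time alpha beta l (link_flow E g l) * link_flow E f l).
  rewrite -!sumrB -big_split /=; apply: eq_bigr => l _.
  by rewrite /D /link_time; ring.
(* The two differences in [sumD] are [T * Q] and [S * Q], each minus a cost at least as large. *)
have {}sumD : \sum_(l <- netNplus | l \in netNplus) D l = 0.
  apply/le_anti/andP; split; last exact: sumr_ge0.
  by rewrite -big_seq sumD; lra.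
have Deq l : l \in netNplus -> link_flow E f l = link_flow E g l.
  move=> lN; move/eqP: sumD; rewrite psumr_eq0 // => /allP/(_ _ lN).
  by rewrite lN mulf_eq0 gt_eqF ?b0 //= sqrf_eq0 subr_eq0 => /eqP.
(* [T * Q] and [S * Q] are total costs, determined by the link flows. *)
apply: (mulIf (lt0r_neq0 Q0)); rewrite -ff -gg.
by apply: eq_big_seq => l lN; rewrite Deq.
Qed.

Lemma T_EqE {f : seq node -> R} {T : R} :
  is_equilibrium alpha beta E Q f -> common_time alpha beta E f T ->
  T_Eq alpha beta E Q = T.
Proof.
move=> ef cT; rewrite /T_Eq; apply: xget_unique; first by exists f.
by move=> S [g [eg cS]]; exact: equilibrium_time_unique eg cS ef cT.
Qed.

End TravelTime.

Theorem theorem2 (R : realType) (alpha beta : nat -> R) (Q : R)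
  (halpha : forall i : nat, (1 <= i <= 5)%N -> 0 <= alpha i)
  (hbeta : forall i : nat, (1 <= i <= 5)%N -> 0 < beta i)
  (hQ : 0 < Q)
  (f fplus : seq node -> R)
  (hf : is_equilibrium alpha beta netN Q f)
  (hfplus : is_equilibrium alpha beta netNplus Q fplus)
  (hN : forall p, p \in paths netN -> ~ vanishing f p)
  (hNplus : forall p, p \in paths netNplus -> (~ vanishing fplus p <-> p = P3)) :
  Braess_paradox alpha beta Q <->
  0 < B2 beta /\
  Num.max
    (Num.max (alpha_ alpha / (beta 1%N + beta 2%N))
             (- alpha_ alpha / (beta 4%N + beta 5%N)))
    ((alpha_hat alpha * (beta 4%N + beta 5%N) + alpha_bar alpha * (beta 1%N + beta 2%N))
       / B2 beta)
  < Q <=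
  Num.min (alpha_hat alpha / (beta 3%N + beta 5%N))
          (alpha_bar alpha / (beta 1%N + beta 3%N)).
Proof.
have [[f0 sumf] [T [cT _]]] := hf.
have [[_ sumfp] [S [cS minS]]] := hfplus.
rewrite /Braess_paradox (T_EqE hbeta hQ hf cT) (T_EqE hbeta hQ hfplus cS).
have pos p : p \in paths netN -> 0 < f p.
  by move=> pN; rewrite lt_def f0 // andbT; apply/eqP/hN.
have pos1 : 0 < f P1 by apply: pos.
have pos2 : 0 < f P2 by apply: pos.
have van p : p \in paths netNplus -> p != P3 -> fplus p = 0.
  move=> pN /eqP p3; have [//|/eqP fp] := eqVneq (fplus p) 0.
  by case: p3; apply/(hNplus _ pN).
have van1 : fplus P1 = 0 by apply: van.
have van2 : fplus P2 = 0 by apply: van.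
have time1 : path_time alpha beta netN f P1 = T by apply: cT => //; exact: hN.
have time2 : path_time alpha beta netN f P2 = T by apply: cT => //; exact: hN.
have time3 : path_time alpha beta netNplus fplus P3 = S.
  by apply: cS => //; apply/hNplus.
have le1 : S <= path_time alpha beta netNplus fplus P1 by apply: minS.
have le2 : S <= path_time alpha beta netNplus fplus P2 by apply: minS.
rewrite paths_N !big_cons big_nil in sumf.
rewrite paths_Nplus !big_cons big_nil in sumfp.
rewrite /path_time /link_flow /link_time paths_N in time1 time2.
rewrite /path_time /link_flow /link_time paths_Nplus in time3 le1 le2.
rewrite /= !(big_cons, big_nil) /= in time1 time2.
rewrite /= !(big_cons, big_nil) /= in time3 le1 le2.
have [b1 b2 b3] : [/\ 0 < beta 1%N, 0 < beta 2%N & 0 < beta 3%N] by split; apply: hbeta.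
have [b4 b5] : 0 < beta 4%N /\ 0 < beta 5%N by split; apply: hbeta.
move: sumf sumfp time1 time2 time3 le1 le2.
rewrite van1 van2 !(addr0, add0r) => sumf -> time1 time2 time3 le1 le2.
have beta0 : 0 < beta_ beta by rewrite /beta_; lra.
have b12 : 0 < beta 1%N + beta 2%N by apply: addr_gt0.
have b13 : 0 < beta 1%N + beta 3%N by apply: addr_gt0.
have b35 : 0 < beta 3%N + beta 5%N by apply: addr_gt0.
have b45 : 0 < beta 4%N + beta 5%N by apply: addr_gt0.
(* Weighting the times of P1 and P2 in N by beta_45 and beta_12 makes their flow terms add up to
   beta_12 beta_45 Q, eliminating the unknown split of Q. *)
have excess : beta_ beta * (S - T) = B2 beta * Q -
    (alpha_hat alpha * (beta 4%N + beta 5%N) + alpha_bar alpha * (beta 1%N + beta 2%N)).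
  have -> : beta_ beta * (S - T) =
      beta_ beta * S - (beta 4%N + beta 5%N) * T - (beta 1%N + beta 2%N) * T.
    by rewrite /beta_; ring.
  rewrite -{1}time1 -time2 -time3 -sumf.
  by rewrite /beta_ /B2 /alpha_hat /alpha_bar /beta_; ring.
(* The link (a,b) common to P1 and P3 cancels in [le1], and (c,d) common to P2 and P3 cancels in
   [le2]. *)
have le_hat : Q * (beta 3%N + beta 5%N) <= alpha_hat alpha by rewrite /alpha_hat; lra.
have le_bar : Q * (beta 1%N + beta 3%N) <= alpha_bar alpha by rewrite /alpha_bar; lra.
(* Equal times of P1 and P2 in N give beta_12 Q - alpha = beta f_{P2} and beta_45 Q + alpha = beta
   f_{P1}. *)
have lt_12 : alpha_ alpha < Q * (beta 1%N + beta 2%N).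
  suff : 0 < f P2 * beta_ beta by rewrite /alpha_ /beta_ -sumf; lra.
  exact: mulr_gt0.
have lt_45 : - alpha_ alpha < Q * (beta 4%N + beta 5%N).
  suff : 0 < f P1 * beta_ beta by rewrite /alpha_ /beta_ -sumf; lra.
  exact: mulr_gt0.
have hat0 : 0 < alpha_hat alpha.
  by apply: lt_le_trans le_hat; apply: mulr_gt0.
have bar0 : 0 < alpha_bar alpha.
  by apply: lt_le_trans le_bar; apply: mulr_gt0.
have threshold0 : 0 <
    alpha_hat alpha * (beta 4%N + beta 5%N) + alpha_bar alpha * (beta 1%N + beta 2%N).
  by apply: addr_gt0; apply: mulr_gt0.
rewrite -subr_gt0 -(pmulr_rgt0 _ beta0) excess subr_gt0.
rewrite !gt_max le_min !ler_pdivlMr // (ltr_pdivrMr _ _ b12) (ltr_pdivrMr _ _ b45).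
(* Four of the five bounds on Q follow from the equilibria alone; what remains is the threshold,
   where division by [B2 beta] requires its sign. *)
rewrite le_hat le_bar lt_12 lt_45 /= andbT.
split=> [lt_B2|[B0]]; last by rewrite ltr_pdivrMr // [Q * _]mulrC.
have B0 : 0 < B2 beta.
  by rewrite -(pmulr_lgt0 _ hQ); exact: lt_trans lt_B2.
by rewrite ltr_pdivrMr // [Q * _]mulrC.
Qed.
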